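(* Let $G$ be a finite group with identity $e$, let $S\subseteq G\setminus\{e\}$ with $S=S^{-1}$, and suppose $\Gamma=\mathrm{Cay}(G,S)$ is a Neumaier graph with parameters $(n,k,\lambda;a,c)$. Then $\Gamma$ has at least $$k(k-\lambda)+(k-c+1)(a-1)+\frac{(k-c+1)(\lambda-a+1)}{2}+\frac{(c-1)(c-2)}{2}$$ edges. Moreover, if $\Gamma$ has exactly this number of edges, then $\Gamma$ is a strongly regular graph with parameters $(n,k,\lambda,k)$ (and is thus a strongly regular Neumaier Cayley graph).
   Context: All graphs are finite, undirected and simple. The Cayley graph $\mathrm{Cay}(G,S)$ has vertex set $G$, with $x\sim y$ iff $xy^{-1}\in S$. A $k$-regular graph on $n$ vertices is edge-regular with parameters $(n,k,\lambda)$ if every two adjacent vertices have exactly $\lambda$ common neighbours. A clique $C$ is regular with nexus $a$ (here $a\ge1$) if every vertex outside $C$ is adjacent to exactly $a$ vertices of $C$. A Neumaier graph with parameters $(n,k,\lambda;a,c)$ is a non-complete edge-regular graph with parameters $(n,k,\lambda)$ having a regular clique of size $c$ with nexus $a$. A strongly regular graph with parameters $(n,k,\lambda,\mu)$: $k$-regular on $n$ vertices, adjacent vertices have $\lambda$ and distinct non-adjacent vertices $\mu$ common neighbours. *)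

(* Defs.v *)
From mathcomp Require Import all_boot all_order all_algebra all_fingroup.
Set Implicit Arguments.
Unset Strict Implicit.
Unset Printing Implicit Defensive.
Import GRing.Theory.

(* A graph on the vertex set T is a symmetric irreflexive relation e : rel T;
   cayley_sym and cayley_irr show that this holds for Cayley graphs. *)
Section Graphs.
Variables (T : finType) (e : rel T).

Definition nbrs (x : T) : {set T} := [set y | e x y].

Definition edges : {set {set T}} := [set [set x; y] | x in T, y in nbrs x].

Definition complete : Prop := forall x y : T, x != y -> e x y.

Definition edge_regular (n k l : nat) : Prop :=
  [/\ #|T| = n,
      forall x, #|nbrs x| = k
    & forall x y, e x y -> #|nbrs x :&: nbrs y| = l].

Definition clique (C : {set T}) : Prop :=
  forall x y, x \in C -> y \in C -> x != y -> e x y.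

Definition regular_clique (C : {set T}) (a : nat) : Prop :=
  [/\ 0 < a, clique C & forall x, x \notin C -> #|nbrs x :&: C| = a].

Definition neumaier (n k l a c : nat) : Prop :=
  [/\ ~ complete,
      edge_regular n k l
    & exists2 C : {set T}, regular_clique C a & #|C| = c].

Definition strongly_regular (n k l m : nat) : Prop :=
  [/\ #|T| = n,
      forall x, #|nbrs x| = k,
      forall x y, e x y -> #|nbrs x :&: nbrs y| = l
    & forall x y, x != y -> ~~ e x y -> #|nbrs x :&: nbrs y| = m].

End Graphs.

Section Cayley.
Local Open Scope group_scope.
Variables (G : finGroupType) (S : {set G}).

Definition cayley : rel G := fun x y => x * y^-1 \in S.

Lemma cayley_sym : S^-1 = S -> symmetric cayley.
Proof. by move=> SV x y; rewrite /cayley -{1}SV inE invMg invgK. Qed.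

Lemma cayley_irr : 1 \notin S -> irreflexive cayley.
Proof. by move=> /negPf S1 x; rewrite /cayley mulgV S1. Qed.

End Cayley.

(* Rational-valued, so that neither the subtractions nor the halves truncate. *)
Definition edge_bound (k l a c : nat) : rat :=
  (k%:R * (k%:R - l%:R)
   + (k%:R - c%:R + 1) * (a%:R - 1)
   + (k%:R - c%:R + 1) * (l%:R - a%:R + 1) / 2
   + (c%:R - 1) * (c%:R - 2) / 2)%R.

(* Main.v *)
Require Import Defs.
From mathcomp Require Import all_boot all_order all_algebra all_fingroup.
From mathcomp Require Import lra.

(** Counting the pairs (z, w) with z in the clique, z <> x, and w a common
    neighbour of x and z turns the bound into k (2k - l) / 2. As the graph has
    n k / 2 edges, the bound reads 2k - l <= n, which holds because two adjacent
    vertices have 2k - l neighbours in total. In case of equality every edge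
    [x y] is dominating, so a non-neighbour z of x is adjacent to every
    neighbour y of x, and x and z have k common neighbours. *)

Set Implicit Arguments.
Unset Strict Implicit.
Unset Printing Implicit Defensive.

Import GRing.Theory Num.Theory.

Section EdgeRegularGraphs.
Variables (T : finType) (e : rel T).
Hypotheses (e_sym : symmetric e) (e_irr : irreflexive e).

(** The map sending [y] to [{x, y}] is a bijection from the neighbours of [x] onto the edges through
    [x]. *)
Lemma card_edges_through (x : T) :
  #|[set E in edges e | x \in E]| = #|nbrs e x|.
Proof.
have -> : [set E in edges e | x \in E] = [set [set x; y] | y in nbrs e x].
  apply/setP => E; rewrite inE; apply/andP/imsetP.
    case=> /imset2P[u v _]; rewrite inE => euv -> /set2P[]->.
      by exists v; rewrite // inE.
    by exists u; rewrite ?inE 1?e_sym // setUC.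
  by case=> y xy ->; rewrite set21; split=> //; apply/imset2P; exists x y.
apply: card_in_imset => y z; rewrite !inE => xy xz eqE.
have: y \in [set x; z] by rewrite -eqE set22.
by case/set2P=> // yx; rewrite yx e_irr in xy.
Qed.

(** Incident vertex-edge pairs are counted by vertex and by edge; irreflexivity gives each edge two
    distinct ends. *)
Lemma handshake : (2 * #|edges e| = \sum_x #|nbrs e x|)%N.
Proof.
under eq_bigr => x _ do rewrite -card_edges_through -sum1dep_card.
rewrite (exchange_big_dep (mem (edges e))) /=; last by move=> x E _ /andP[].
rewrite mulnC -sum_nat_const; apply: eq_bigr => E edE.
rewrite (eq_bigl (mem E)) => [|x /=]; last by rewrite edE.
rewrite sum1_card; case/imset2P: edE => u v _; rewrite inE => euv ->.
by rewrite cards2; case: eqP euv => // ->; rewrite e_irr.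
Qed.

Variables (n k l : nat).
Hypothesis reg : edge_regular e n k l.

Lemma edge_regular_handshake : (2 * #|edges e| = n * k)%N.
Proof.
case: reg => cT degk _; rewrite handshake.
by under eq_bigr => x _ do rewrite degk; rewrite sum_nat_const cT.
Qed.

Lemma card_nbrsU (x y : T) :
  e x y -> (#|nbrs e x :|: nbrs e y| + l = k + k)%N.
Proof.
by case: reg => _ degk lam exy; rewrite -(lam x y exy) cardsUI !degk.
Qed.

Lemma edge_regular_order_ge (x y : T) : e x y -> (k + k <= n + l)%N.
Proof.
case: reg => <- _ _ exy.
by rewrite -(card_nbrsU exy) leq_add2r max_card.
Qed.

Lemma edge_regular_tight_srg : (n + l = k + k)%N -> strongly_regular e n k l k.
Proof.
move=> tight; case: (reg) => cT degk lam; split=> // x z x_z nexz.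
(* As [nbrs e x] has [k] elements, it suffices that it lies inside [nbrs e z]. *)
rewrite -(degk x); congr #|pred_of_set _|; apply/setIidPl/subsetP => y.
rewrite !inE => exy.
have full : nbrs e x :|: nbrs e y = [set: T].
  apply/eqP; rewrite eqEcard subsetT cardsT cT /=.
  by rewrite -(leq_add2r l) card_nbrsU // tight.
have := in_setT z; rewrite -full !inE (negPf nexz) /=.
by rewrite e_sym.
Qed.

Variables (C : {set T}) (a : nat).
Hypothesis regC : regular_clique e C a.

Lemma clique_nbrs (x : T) : x \in C -> C :\ x = nbrs e x :&: C.
Proof.
case: regC => _ cliqueC _ xC; apply/setP => z; rewrite !inE.
have [zC | _] := boolP (z \in C); last by rewrite !andbF.
rewrite !andbT; have [-> | z_x] := eqVneq z x; first by rewrite e_irr.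
by rewrite cliqueC // eq_sym.
Qed.

Lemma regular_clique_count (x : T) : x \in C ->
  (#|C :\ x| * l = #|C :\ x| * #|C :\ x|.-1 + #|nbrs e x :\: C| * a.-1)%N.
Proof.
case: regC reg => _ cliqueC nexus [_ _ lam] xC.
have -> : (#|C :\ x| * l = \sum_(z in C :\ x) #|nbrs e x :&: nbrs e z|)%N.
  rewrite -sum_nat_const; apply: eq_bigr => z; rewrite !inE => /andP[z_x zC].
  by rewrite lam // cliqueC // eq_sym.
under eq_bigr => z _ do rewrite -sum1_card.
rewrite (exchange_big_dep (mem (nbrs e x))) /=; last by move=> z w _ /setIP[].
under eq_bigr => w xw.
  rewrite sum1dep_card.
  have -> : [set z | (z \in C :\ x) && (w \in nbrs e x :&: nbrs e z)]
            = (nbrs e w :&: C) :\ x.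
    apply/setP => z; move: xw; rewrite !inE => ->.
    by rewrite /= e_sym -andbA [(z \in C) && _]andbC.
  over.
(* A [w] in the clique is paired with every clique vertex except [w] and [x]; a [w] outside is
   paired with its [a] clique neighbours except [x]. *)
rewrite (big_setID C) /= -clique_nbrs //; congr addn.
  rewrite -sum_nat_const; apply: eq_bigr => w wCx.
  have /setD1P[w_x wC] := wCx.
  rewrite -(clique_nbrs wC) setDDl setUC -setDDl.
  by rewrite [#|C :\ x|](cardsD1 w) wCx.
rewrite -sum_nat_const; apply: eq_bigr => w; rewrite !inE => /andP[wC xw].
by rewrite -(nexus _ wC) [in RHS](cardsD1 x) !inE xC e_sym xw.
Qed.

Lemma edge_boundE : (0 < #|C|)%N ->
  (edge_bound k l a #|C| = k%:R * (k%:R + k%:R - l%:R) / 2)%R.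
Proof.
case: (regC) => a_gt0 _ _ /card_gt0P[x xC]; have := regular_clique_count xC.
have cC : #|C| = #|C :\ x|.+1 by rewrite (cardsD1 x) xC.
have ck : k = (#|C :\ x| + #|nbrs e x :\: C|)%N.
  by case: (reg) => _ degk _; rewrite -(degk x) clique_nbrs // cardsID.
rewrite cC ck -(prednK a_gt0) /edge_bound /=.
(* With p = c - 1, m = k - c + 1 and b = a - 1, the bound is k(k - l) + (p(p - 1) + mb + ml)/2, and
   the count turns the bracket into (p + m)l = kl. *)
move: #|C :\ x| #|nbrs e x :\: C| a.-1 => p m b count.
have {count} : (p%:R * l%:R = p%:R * (p%:R - 1) + m%:R * b%:R :> rat)%R.
  rewrite -!natrM count natrD !natrM; congr (_ + _)%R.
  (* At p = 0 the truncated predecessor is harmless, being multiplied by 0. *)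
  by case: p {count} => [|p]; rewrite ?mul0r //= -natr1 addrK.
rewrite natrD -[p.+1%:R%R]natr1 -[b.+1%:R%R]natr1 => count; lra.
Qed.

End EdgeRegularGraphs.

(** If the clique contained every vertex, the graph would be complete; a vertex outside has a
    neighbour in the clique because the nexus is positive. *)
Lemma neumaier_adjacent_pair (T : finType) (e : rel T) (C : {set T}) (a : nat) :
  ~ complete e -> regular_clique e C a ->
  (0 < #|C|)%N /\ exists x y, e x y.
Proof.
move=> ncomp [a_gt0 cliqueC nexus].
have [x xC] : exists x, x \notin C.
  case: (pickP [predC C]) => [x xC | CT]; first by exists x.
  case: ncomp => x y; apply: cliqueC; exact/negPn/negbT/CT.
have: (0 < #|nbrs e x :&: C|)%N by rewrite nexus.
case/card_gt0P=> y; rewrite !inE => /andP[exy yC].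
by split; [apply/card_gt0P; exists y | exists x, y].
Qed.

Theorem theorem3p4 (G : finGroupType) (S : {set G}) (n k l a c : nat)
    (S1 : (1%g : G) \notin S) (SV : (S^-1)%g = S)
    (hN : neumaier (cayley S) n k l a c) :
  (edge_bound k l a c <= #|edges (cayley S)|%:R)%R /\
  (#|edges (cayley S)|%:R%R = edge_bound k l a c ->
     strongly_regular (cayley S) n k l k /\ neumaier (cayley S) n k l a c).
Proof.
have e_sym := cayley_sym SV; have e_irr := cayley_irr S1.
case: (hN) => ncomp reg [C regC cC].
have [C_gt0 [x [y exy]]] := neumaier_adjacent_pair ncomp regC.
have := edge_boundE e_sym e_irr reg regC C_gt0; rewrite cC => ->.
have k_gt0 : (0 < k)%N.
  by case: reg => _ degk _; rewrite -(degk x); apply/card_gt0P; exists y; rewrite inE.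
have -> : (#|edges (cayley S)|%:R = k%:R * n%:R / 2 :> rat)%R.
  have := congr1 (fun m => m%:R%R : rat) (edge_regular_handshake e_sym e_irr reg).
  by rewrite !natrM => ?; lra.
(* Cancelling this common factor leaves a comparison of 2k - l with n, for the inequality and for
   the equality alike. *)
have kR : (0 < k%:R / 2 :> rat)%R by rewrite divr_gt0 ?ltr0n.
split.
  rewrite ![(k%:R * _ / 2)%R]mulrAC ler_pM2l // lerBlDr -!natrD ler_nat.
  exact: edge_regular_order_ge reg _ _ exy.
rewrite ![(k%:R * _ / 2)%R]mulrAC => /(mulfI (lt0r_neq0 kR)) nE; split=> //.
apply: (edge_regular_tight_srg e_sym reg); apply/eqP.
by rewrite -(eqr_nat rat) !natrD nE subrK.
Qed.
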